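(* Let $n\ge 4$ be an even integer, $m$ a positive integer, $(\Lambda,b)$ a lattice of type $D_n$, and let $C$ be an $\mathbb{F}_4$-code of length $m$. Let $\Gamma_C=(\rho^{\oplus m})^{-1}(C)$ be the associated lattice with form $B$ (see context). (a) If $n\in2\mathbb{Z}$ and $n\notin4\mathbb{Z}$, then: 1. $\Gamma_C$ is integral if and only if $C\subset C^\perp$. 2. $\Gamma_C$ is unimodular if and only if $C$ is Euclidean self-dual. 3. $\Gamma_C$ is even if and only if $\mathrm{wt}_{\mathrm L}(x)\in4\mathbb{Z}$ for every $x\in C$. 4. $\Gamma_C$ is even unimodular if and only if $C$ is Type II. (b) If $n\in4\mathbb{Z}$ and $n\notin8\mathbb{Z}$, then: 1. $\Gamma_C$ is integral if and only if $C\subset\overline{C}^\perp$. 2. $\Gamma_C$ is unimodular if and only if $C$ is Hermitian self-dual. 3. $\Gamma_C$ is even if and only if $\mathrm{wt}_{\mathrm H}(x)\in2\mathbb{Z}$ for every $x\in C$. 4. $\Gamma_C$ is even unimodular if and only if $C$ is Hermitian self-dual. (c) If $n\in8\mathbb{Z}$, then: 1. $\Gamma_C$ is integral if and only if $C\subset\overline{C}^\perp$. 2. $\Gamma_C$ is unimodular if and only if $C$ is Hermitian self-dual. 3. $\Gamma_C$ is even if and only if $\mathrm{wt}_{\mathrm B}(x)\in2\mathbb{Z}$ for every $x\in C$. 4. $\Gamma_C$ is even unimodular if and only if $C$ is Hermitian self-dual and $\mathrm{wt}_{\mathrm B}(x)\in2\mathbb{Z}$ for every $x\in C$.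
   Context: **Lattices.** A lattice is a free $\mathbb{Z}$-module $\Lambda$ of finite rank with a positive-definite symmetric bilinear form $b$ to $\mathbb{R}$, extended to $\Lambda\otimes\mathbb{R}$; its dual is $\Lambda^*=\{x\in\Lambda\otimes\mathbb{R}: b(x,y)\in\mathbb{Z}\ \forall y\in\Lambda\}$. It is integral if $b$ is $\mathbb{Z}$-valued on it, even if it is integral and $b(x,x)\in2\mathbb{Z}$ for all $x$, unimodular if $\Lambda^*=\Lambda$. $\Lambda$ is of type $D_n$ ($n\ge4$) if it has a basis $(e_1,\dots,e_n)$ with $b(e_i,e_i)=2$, $b(e_i,e_j)=-1$ if ($|i-j|=1$ and $\{i,j\}\ne\{n-1,n\}$) or $\{i,j\}=\{n-2,n\}$, and $0$ otherwise. **Construction.** With such a basis, let $f_i=e_i$ for $1\le i\le n-1$, $f_n=e_n+\sum_{l=1}^{n-2}e_l$, and $f_i^*=\sum_{l=1}^n\frac14(n-2|i-l|)f_l$. Then $b(f_i,f_j^* )=\delta_{ij}$, $(f_i)$ is a basis of $\Lambda$ and $(f_i^* )$ is a basis of $\Lambda^*$. Let $\mathbb{F}_4=\{0,1,\omega,\bar\omega\}$ with $\bar\omega=\omega^2=\omega+1$. Define the additive homomorphism $\rho^{\oplus m}:(\Lambda^* )^{\oplus m}\to\mathbb{F}_4^{\oplus m}$ by $$\Big(\sum_{j=1}^n x_{ij}f_j^*\Big)_{1\le i\le m}\mapsto\Big(\big(\textstyle\sum_{j=1}^{n/2}x_{i(2j-1)}\bmod 2\big)\omega+\big(\sum_{j=1}^{n/2}x_{i(2j)}\bmod2\big)\omega^2\Big)_{1\le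 i\le m}\qquad(x_{ij}\in\mathbb{Z}).$$ For a code $C$ put $\Gamma_C=(\rho^{\oplus m})^{-1}(C)$, a lattice with form $B(x,y)=\sum_{i=1}^m b(x_i,y_i)$. **Codes.** An $\mathbb{F}_4$-code of length $m$ is an $\mathbb{F}_4$-subspace $C\subset\mathbb{F}_4^{\oplus m}$. With $x\cdot y=\sum x_iy_i$, $C^\perp=\{x:x\cdot y=0\ \forall y\in C\}$. Conjugation is $\overline{x}=x^2$ on $\mathbb{F}_4$, applied coordinatewise to vectors and codes; $\overline{C}^\perp=(\overline C)^\perp$. $C$ is Euclidean self-dual if $C=C^\perp$, Hermitian self-dual if $C=\overline{C}^\perp$. For $x\in\mathbb{F}_4^{\oplus m}$: $N_0(x)$ is the number of coordinates equal to $0$, $N_2(x)$ the number equal to $1$, $N_1(x)=m-N_0(x)-N_2(x)$; $\mathrm{wt}_{\mathrm H}=N_1+N_2$ (Hamming), $\mathrm{wt}_{\mathrm L}=N_1+2N_2$ (Lee), $\mathrm{wt}_{\mathrm B}=2N_1+N_2$ (Bachoc). A Euclidean self-dual $\mathbb{F}_4$-code is Type II if $\mathrm{wt}_{\mathrm L}(x)\in4\mathbb{Z}$ for all $x\in C$. *)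

(* Defs.v *)
From mathcomp Require Import all_boot all_order all_algebra.
From mathcomp Require Import all_classical all_reals.

Set Implicit Arguments.
Unset Strict Implicit.
Unset Printing Implicit Defensive.

Import Order.TTheory GRing.Theory Num.Theory.

Local Open Scope ring_scope.
Local Open Scope classical_set_scope.

(** A lattice is handled inside the real vector space [V] that it spans: [V]
    plays the role of [L (x) R], [L] is the Z-span of an R-basis of [V], and
    the form is given on [V]. *)

Section Lattices.
Context {R : realType} {V : vectType R}.
Implicit Types (b : V -> V -> R) (L : set V).

Definition Zspan k (e : k.-tuple V) : set V :=
  [set x | exists z : 'I_k -> int, x = \sum_(i < k) (z i)%:~R *: tnth e i].

Definition lattice_basis k L (e : k.-tuple V) : Prop :=
  basis_of fullv e /\ L = Zspan e.

Definition lattice_dual b L : set V :=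
  [set x | forall y, L y -> b x y \is a Num.int].

Definition integral_lattice b L : Prop :=
  forall x y, L x -> L y -> b x y \is a Num.int.

Definition even_lattice b L : Prop :=
  integral_lattice b L /\
  forall x, L x -> exists k : int, b x x = (2 * k)%:~R.

Definition unimodular_lattice b L : Prop := lattice_dual b L = L.

End Lattices.

(** Indices [i : 'I_n] start at 0, so that [tnth e i] is e_(i+1). *)

Definition same_pair (i j k l : nat) : bool :=
  ((i == k) && (j == l)) || ((i == l) && (j == k)).

Definition Dn_adjacent (n i j : nat) : bool :=
  (((i.+1 == j) || (j.+1 == i)) && ~~ same_pair i j (n - 2) (n - 1))
  || same_pair i j (n - 3) (n - 1).

Section TypeD.
Context {R : realType} {V : vectType R} {n : nat}.
Implicit Types (b : V -> V -> R) (L : set V) (e : n.-tuple V).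

Definition Dn_gram (i j : nat) : R :=
  if i == j then 2 else if Dn_adjacent n i j then -1 else 0.

Definition Dn_basis b L e : Prop :=
  lattice_basis L e /\
  forall i j : 'I_n, b (tnth e i) (tnth e j) = Dn_gram i j.

Definition f_basis e : n.-tuple V :=
  [tuple if (i.+1 < n)%N then tnth e i
         else tnth e i + \sum_(l < n | (l < n - 2)%N) tnth e l | i < n].

Definition fstar_basis e : n.-tuple V :=
  [tuple \sum_(l < n)
     ((n%:R - 2 * `|i%:R - l%:R|) / 4 : R) *: tnth (f_basis e) l | i < n].

End TypeD.

Section Construction.
Context {R : realType} {V : vectType R} {n : nat} {F : finFieldType}.
Context (omega : F) (e : n.-tuple V).

(* On the dual lattice the coordinates in [fstar_basis e] are integers, so
   [Num.floor] merely reads them in [int]; elsewhere the value is irrelevant. *)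
Definition fstar_coord (x : V) (j : 'I_n) : int :=
  Num.floor (coord (fstar_basis e) j x).

(* In characteristic 2, [%:~R] is reduction mod 2.  The odd positions
   1, 3, ..., n-1 are the even [j : 'I_n]. *)
Definition rho (x : V) : F :=
  (\sum_(j < n | ~~ odd j) fstar_coord x j)%:~R * omega +
  (\sum_(j < n | odd j) fstar_coord x j)%:~R * omega ^+ 2.

Definition rho_sum m (x : {ffun 'I_m -> V}) : 'rV[F]_m :=
  \row_i rho (x i).

Definition Gamma (b : V -> V -> R) (L : set V) m (C : {vspace 'rV[F]_m}) :
    set {ffun 'I_m -> V} :=
  [set x : {ffun 'I_m -> V} |
    (forall i, lattice_dual b L (x i)) /\ rho_sum x \in C].

End Construction.

Definition form_sum (R : realType) (V : vectType R) m (b : V -> V -> R)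
    (x y : {ffun 'I_m -> V}) : R :=
  \sum_(i < m) b (x i) (y i).

Section Codes.
Context {F : finFieldType} {m : nat}.
Implicit Types (x y : 'rV[F]_m) (S : {set 'rV[F]_m}) (C : {vspace 'rV[F]_m}).

Definition code_dot x y : F := \sum_(i < m) x 0 i * y 0 i.

Definition code_dual S : {set 'rV[F]_m} :=
  [set x | [forall y in S, code_dot x y == 0]]%SET.

Definition code_conj S : {set 'rV[F]_m} :=
  [set map_mx (fun a => a ^+ 2) x | x in S]%SET.

Definition code_set C : {set 'rV[F]_m} := [set x in C]%SET.

Definition euclidean_dual C : {set 'rV[F]_m} := code_dual (code_set C).

Definition hermitian_dual C : {set 'rV[F]_m} :=
  code_dual (code_conj (code_set C)).

Definition euclidean_selfdual C : Prop := code_set C = euclidean_dual C.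

Definition hermitian_selfdual C : Prop := code_set C = hermitian_dual C.

Definition N0 x : nat := #|[set i | x 0%R i == 0]%SET|.
Definition N2 x : nat := #|[set i | x 0%R i == 1]%SET|.
Definition N1 x : nat := (m - N0 x - N2 x)%N.

Definition wtH x : nat := (N1 x + N2 x)%N.
Definition wtL x : nat := (N1 x + 2 * N2 x)%N.
Definition wtB x : nat := (2 * N1 x + N2 x)%N.

Definition typeII C : Prop :=
  euclidean_selfdual C /\ forall x, x \in C -> (4 %| wtL x)%N.

End Codes.

(* Main.v *)
Require Import Defs.
From mathcomp Require Import all_boot all_order all_algebra finfield.
From mathcomp Require Import all_classical all_reals.
From mathcomp Require Import ring lra zify.

Set Implicit Arguments.
Unset Strict Implicit.
Unset Printing Implicit Defensive.

Import Order.TTheory GRing.Theory Num.Theory.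

Local Open Scope ring_scope.

(** Realize the type D_n lattice as the vectors of Z^n with even coordinate
    sum, so that e_k = eps_k - eps_(k+1) for k < n and
    e_n = eps_(n-1) + eps_n for an orthonormal basis (eps_k).  Then
    f_n = eps_n + eps_1, and a vector belongs to the dual lattice exactly when
    its coordinates are all integers or all half-integers: they have the form
    z_k + h/2 with z_k in Z and a common bit h.  Put s = z_1 + ... + z_n.
    Reading the coordinates x_j = b(x, f_j) modulo 2 gives
      rho(x) = s + h omega^2
    ([rho_half_integral]), while expanding the form gives, for y with data
    (w, h', s'),
      2 b(x, y) = 2 sum_k z_k w_k + h' s + h s' + (n/2) h h'
    ([double_form_half_integral]).

    Modulo 2 the right-hand side is the trace from F_4 to F_2 of
    rho(x) rho(y) when n/2 is odd and of rho(x) rho(y)^2 when n/2 is even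
    ([form_trace_rho]); hence the Euclidean and Hermitian dualities.  When
    y = x one has sum_k z_k^2 = s modulo 2, and the right-hand side is
    determined modulo 4 by rho(x): it is 0, 2 or n/2 according to whether
    rho(x) is 0, 1 or one of omega, omega^2 ([norm_residue_weight]).

    Summing over the m components, B(x, y) is an integer if and only if the
    trace of the twisted product of the two codewords vanishes, and B(x, x) is
    an even integer if and only if 4 divides (n/2) N1 + 2 N2 for the codeword
    of x.  As rho is onto F_4, the trace form is nondegenerate and C is stable
    under scalars, the dual of Gamma_C is the preimage of the twisted dual of C
    ([dual_Gamma]), which gives integrality and unimodularity.  Evenness
    follows by polarization ([even_Gamma]), and (n/2) N1 + 2 N2 modulo 4 is the
    Lee, Hamming or Bachoc condition according to n modulo 8.  When n is 4
    modulo 8, Hermitian self-duality alone forces evenness, because the Hermitian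
    norm of a word is its Hamming weight modulo 2. *)

(** * The field with four elements *)

Section FieldOfOrderFour.
Context {F : finFieldType} (cardF : #|F| = 4%N).
Context {omega : F} (omega2 : omega ^+ 2 = omega + 1).
Implicit Types (a t u : F).

Lemma F4_char2 : 2 \in [pchar F].
Proof. by apply: (@card_finPcharP F 2 2). Qed.

Lemma F4_addrr a : a + a = 0.
Proof. exact: (addrr_pchar2 F4_char2). Qed.

Lemma F4_oppr a : - a = a.
Proof. exact: (oppr_pchar2 F4_char2). Qed.

Lemma F4_natr k : k%:R = (odd k)%:R :> F.
Proof.
by rewrite -{1}(odd_double_half k) natrD -mul2n natrM (pcharf0 F4_char2) mul0r addr0.
Qed.

Lemma F4_intr_eq0 (z : int) : (z%:~R == 0 :> F) = (2 %| z)%Z.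
Proof.
have abszF : (z%:~R == 0 :> F) = (`|z|%N%:R == 0 :> F).
  by case: z => k; rewrite ?NegzE ?mulrNz ?oppr_eq0.
by rewrite abszF -(dvdn_pcharf F4_char2) dvdzE.
Qed.

Lemma omega_add_omega2 : omega + omega ^+ 2 = 1.
Proof. by rewrite omega2 addrA F4_addrr add0r. Qed.

Lemma one_add_omega2 : 1 + omega ^+ 2 = omega.
Proof. by rewrite -omega_add_omega2 -addrA F4_addrr addr0. Qed.

Lemma omega_neq0 : omega != 0.
Proof.
apply/eqP => w0; have := omega2; rewrite w0 expr0n add0r /=.
by move/eqP; rewrite eq_sym oner_eq0.
Qed.

Lemma omega3 : omega ^+ 3 = 1.
Proof.
by rewrite exprS omega2 mulrDr mulr1 -expr2 addrC omega_add_omega2.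
Qed.

Lemma omega4 : omega ^+ 4 = omega.
Proof. by rewrite exprS omega3 mulr1. Qed.

(** The bits s and h are the ones that [rho] reads off a dual vector. *)
Lemma F4_elements a :
  exists s h : bool, a = s%:R + h%:R * omega ^+ 2.
Proof.
have : a * (a - 1) * (a - omega) * (a - omega ^+ 2) = 0.
  (* These are the roots of X^4 - X: compare elementary symmetric functions. *)
  have -> : a * (a - 1) * (a - omega) * (a - omega ^+ 2) =
    a ^+ 4 - (omega + omega ^+ 2 + 1) * a ^+ 3
    + (omega + omega ^+ 2 + omega ^+ 3) * a ^+ 2 - omega ^+ 3 * a by ring.
  rewrite -cardF expf_card omega_add_omega2 omega3 F4_addrr.
  by rewrite !mul0r subr0 addr0 mul1r subrr.
move/eqP; rewrite !mulf_eq0 !subr_eq0.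
case/orP => [/orP[/orP[]|]|] /eqP ->.
- by exists false, false; rewrite mul0r addr0.
- by exists true, false; rewrite mul0r addr0.
- by exists true, true; rewrite mul1r one_add_omega2.
- by exists false, true; rewrite mul1r add0r.
Qed.

Lemma F4_cube a : a != 0 -> a ^+ 3 = 1.
Proof.
move=> a0; apply: (mulfI a0); rewrite -exprS mulr1 -[RHS]expf_card.
by rewrite cardF.
Qed.

(** The field trace onto the prime field, with values in F. *)
Definition trace t : F := t + t ^+ 2.

Lemma traceD t u : trace (t + u) = trace t + trace u.
Proof.
have /eqP := F4_addrr (t * u); rewrite /trace.
have -> : t + u + (t + u) ^+ 2 = t + t ^+ 2 + (u + u ^+ 2) + (t * u + t * u).
  by ring.
by move/eqP ->; rewrite addr0.
Qed.

Lemma trace_sum I r (P : pred I) (E : I -> F) :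
  trace (\sum_(i <- r | P i) E i) = \sum_(i <- r | P i) trace (E i).
Proof.
apply: (big_morph trace traceD).
by rewrite /trace expr0n addr0.
Qed.

Lemma trace_bit a : a ^+ 2 = a -> trace a = 0.
Proof. by move=> aa; rewrite /trace aa F4_addrr. Qed.

Lemma trace_bit_omega a : a ^+ 2 = a -> trace (a * omega) = a.
Proof.
by move=> aa; rewrite /trace exprMn aa -mulrDr omega_add_omega2 mulr1.
Qed.

Lemma trace_bit_omega2 a : a ^+ 2 = a -> trace (a * omega ^+ 2) = a.
Proof.
move=> aa; rewrite /trace exprMn aa -exprM omega4 -mulrDr addrC.
by rewrite omega_add_omega2 mulr1.
Qed.

(** A trace zero t is a bit; then u t has trace (u + u^2) t = t. *)
Lemma trace_nondegenerate u t : u ^+ 2 = u + 1 ->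
  trace t = 0 -> trace (u * t) = 0 -> t = 0.
Proof.
move=> u2 /eqP; rewrite /trace addr_eq0 F4_oppr => /eqP t2 /eqP.
rewrite exprMn -t2 u2 -mulrDl addrA F4_addrr add0r mul1r => /eqP. 
by [].
Qed.

Lemma omega2_quadratic : (omega ^+ 2) ^+ 2 = omega ^+ 2 + 1.
Proof. by rewrite -exprM omega4 omega2 -addrA F4_addrr addr0. Qed.

Lemma bitr_idem (k : nat) : (k%:R : F) ^+ 2 = k%:R.
Proof. by rewrite F4_natr; case: odd; rewrite ?expr1n ?expr0n. Qed.

Lemma intr_idem (z : int) : (z%:~R : F) ^+ 2 = z%:~R.
Proof.
case: z => k; first exact: bitr_idem.
by rewrite NegzE mulrNz sqrrN bitr_idem F4_oppr.
Qed.

(** Products in the basis 1, omega^2 only involve 1, omega^2 and omega^4 = omega,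
    and the trace kills the coefficient of 1. *)
Lemma trace_euclidean (s s' h h' : int) :
  trace ((s%:~R + h%:~R * omega ^+ 2) * (s'%:~R + h'%:~R * omega ^+ 2)) =
  (h' * s + h * s' + h * h')%:~R.
Proof.
have -> : (s%:~R + h%:~R * omega ^+ 2) * (s'%:~R + h'%:~R * omega ^+ 2) =
  (s * s')%:~R + (h' * s + h * s')%:~R * omega ^+ 2 + (h * h')%:~R * omega ^+ 4.
  by rewrite !intrD !intrM; ring.
rewrite omega4 !traceD (trace_bit (intr_idem _)) (trace_bit_omega2 (intr_idem _)).
rewrite (trace_bit_omega (intr_idem _)).
by rewrite add0r -intrD.
Qed.

(** Squaring turns omega^2 into omega, so that the product of the two
    omega-components becomes omega^3 = 1 and is killed by the trace. *)
Lemma trace_hermitian (s s' h h' : int) :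
  trace ((s%:~R + h%:~R * omega ^+ 2) * (s'%:~R + h'%:~R * omega ^+ 2) ^+ 2) =
  (h' * s + h * s')%:~R.
Proof.
have -> : (s'%:~R + h'%:~R * omega ^+ 2) ^+ 2 = s'%:~R + h'%:~R * omega.
  rewrite sqrrD exprMn !intr_idem -exprM omega4 mulr2n F4_addrr.
  by rewrite addr0.
have -> : (s%:~R + h%:~R * omega ^+ 2) * (s'%:~R + h'%:~R * omega) =
  (s * s')%:~R + (h' * s)%:~R * omega + (h * s')%:~R * omega ^+ 2
  + (h * h')%:~R * omega ^+ 3.
  by rewrite !intrM; ring.
rewrite omega3 mulr1 !traceD !(trace_bit (intr_idem _)) (trace_bit_omega (intr_idem _)).
rewrite (trace_bit_omega2 (intr_idem _)).
by rewrite add0r addr0 intrD.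
Qed.

(** Stated for the exponents 1 and 2 at once, to treat the Euclidean and the
    Hermitian product together. *)
Lemma trace_form_nondegenerate kappa t : kappa \in [:: 1; 2]%N ->
  (forall a, trace (t * a ^+ kappa) = 0) -> t = 0.
Proof.
move=> kappa12 tr0; apply: (@trace_nondegenerate (omega ^+ kappa)).
- by move: kappa12; rewrite !inE => /orP[] /eqP ->; rewrite ?expr1 ?omega2_quadratic.
- by have := tr0 1; rewrite expr1n mulr1.
- by rewrite mulrC.
Qed.

Lemma omega2_neq1 : omega ^+ 2 != 1.
Proof.
by rewrite omega2 -subr_eq0 addrK omega_neq0.
Qed.

Lemma omega_neq1 : omega != 1.
Proof. by apply: contra_neq omega2_neq1 => ->; rewrite expr1n. Qed.

End FieldOfOrderFour.

(** * The lattice of type D_n in orthonormal coordinates *)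

Section DotProducts.
Context {R : realType} {V : vectType R} (b : {dot V for (@idfun R)}).
Implicit Types (x y : V).

Lemma dotC x y : b x y = b y x.
Proof. by rewrite hermC /= expr0 mul1r. Qed.

Lemma dotDl x1 x2 y : b (x1 + x2) y = b x1 y + b x2 y.
Proof. exact: linearDl. Qed.

Lemma dotDr x y1 y2 : b x (y1 + y2) = b x y1 + b x y2.
Proof. exact: linearDr. Qed.

Lemma dotZl a x y : b (a *: x) y = a * b x y.
Proof. by rewrite linearZl_LR. Qed.

Lemma dotZr a x y : b x (a *: y) = a * b x y.
Proof. by rewrite dotC dotZl dotC. Qed.

Lemma dot_suml I r (P : pred I) (E : I -> V) y :
  b (\sum_(i <- r | P i) E i) y = \sum_(i <- r | P i) b (E i) y.
Proof. exact: linear_sumlz. Qed.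

Lemma dot_sumr I r (P : pred I) (E : I -> V) y :
  b y (\sum_(i <- r | P i) E i) = \sum_(i <- r | P i) b y (E i).
Proof. exact: linear_sumr. Qed.

End DotProducts.

Section RootCoordinates.
Context {R : realType} {n : nat} (n_ge4 : (4 <= n)%N).
Implicit Types (g : nat -> R) (i j k : nat).

(** Indices start at 0: this is the coordinate on eps_(k+1) of the root e_(i+1),
    which is eps_(i+1) - eps_(i+2), or eps_(n-1) + eps_n for the last root. *)
Definition root_coord i k : R :=
  if (i.+1 < n)%N then (k == i)%:R - (k == i.+1)%:R
  else (k == n - 2)%N%:R + (k == n - 1)%N%:R.

Lemma sum_mul_delta g a : (a < n)%N -> \sum_(k < n) g k * (k == a :> nat)%:R = g a.
Proof.
move=> an; rewrite (bigD1 (Ordinal an)) //= eqxx mulr1 big1 ?addr0 // => k.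
by rewrite -val_eqE /= => /negbTE ->; rewrite mulr0.
Qed.

Lemma sum_mul_root_coord g j : (j < n)%N ->
  \sum_(k < n) g k * root_coord j k =
  if (j.+1 < n)%N then g j - g j.+1 else g (n - 2)%N + g (n - 1)%N.
Proof.
move=> jn; rewrite /root_coord; case: ifP => jn1.
  under eq_bigr do rewrite mulrBr.
  by rewrite sumrB !sum_mul_delta.
under eq_bigr do rewrite mulrDr.
by rewrite big_split /= !sum_mul_delta //; lia.
Qed.

(** This identity is what makes [eps_coord] below isometric. *)
Lemma root_coord_gram i j : (i < n)%N -> (j < n)%N ->
  \sum_(k < n) root_coord i k * root_coord j k = Dn_gram (R := R) (n := n) i j.
Proof.
move=> i_n jn; rewrite sum_mul_root_coord // /root_coord /Dn_gram /Dn_adjacent /same_pair.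
case: (ltnP i.+1 n) => i1; case: (ltnP j.+1 n) => j1;
repeat (match goal with |- context[(?a == ?b) ] => 
   case: (@eqP nat a b) => ? end; try (exfalso; lia));
 rewrite /=; by [lra | exfalso; lia].
Qed.

End RootCoordinates.

Section TypeDLattice.
Context {R : realType} {V : vectType R} (b : {dot V for (@idfun R)}).
Context {L : set V} {n : nat} {e : n.-tuple V}.
Context (n_ge4 : (4 <= n)%N) (Dn_e : Dn_basis b L e).
Implicit Types (x y : V) (i j k : nat).

(** The coordinates of x in the orthonormal basis (eps_k), obtained from its
    coordinates in the roots without constructing the eps_k. *)
Definition eps_coord x k : R :=
  \sum_(i < n) coord e i x * root_coord (n := n) i k.

Lemma basis_expansion x : x = \sum_(i < n) coord e i x *: tnth e i.
Proof.
have [[be _] _] := Dn_e.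
rewrite [LHS](coord_basis be (memvf x)).
by apply: eq_bigr => i _; rewrite (tnth_nth 0).
Qed.

Lemma form_eps_coord x y : b x y = \sum_(k < n) eps_coord x k * eps_coord y k.
Proof.
rewrite {1}(basis_expansion x) {1}(basis_expansion y) dot_suml.
under eq_bigr do rewrite dotZl dot_sumr mulr_sumr.
under [RHS]eq_bigr do rewrite mulr_suml.
rewrite [RHS]exchange_big /=; apply: eq_bigr => i _.
under [RHS]eq_bigr do rewrite mulr_sumr.
rewrite [RHS]exchange_big /=; apply: eq_bigr => j _.
rewrite dotZr (Dn_e.2 i j) -root_coord_gram // !mulr_sumr.
by apply: eq_bigr => k _; ring.
Qed.

Lemma eps_coord_root (j : 'I_n) k : eps_coord (tnth e j) k = root_coord (n := n) j k.
Proof.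
have [[be _] _] := Dn_e.
rewrite /eps_coord (bigD1 j) //= big1 ?addr0 => [|i ij]; last first.
  by rewrite (tnth_nth 0) coord_free ?(basis_free be) // eq_sym (negbTE ij) mul0r.
by rewrite (tnth_nth 0) coord_free ?(basis_free be) // eqxx mul1r.
Qed.

Lemma form_root x (j : 'I_n) :
  b x (tnth e j) = if (j.+1 < n)%N then eps_coord x j - eps_coord x j.+1
                   else eps_coord x (n - 2) + eps_coord x (n - 1).
Proof.
rewrite form_eps_coord.
under eq_bigr do rewrite eps_coord_root.
exact: sum_mul_root_coord.
Qed.

Lemma f_basisE (j : 'I_n) : tnth (f_basis e) j =
  if (j.+1 < n)%N then tnth e j
  else tnth e j + \sum_(l < n | (l < n - 2)%N) tnth e l.
Proof. by rewrite tnth_mktuple. Qed.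

Lemma sum_first (W : zmodType) (g : nat -> W) :
  \sum_(l < n | (l < n - 2)%N) (g l - g l.+1) = g 0%N - g (n - 2)%N.
Proof.
rewrite -(big_mkord (fun l => (l < n - 2)%N) (fun l => g l - g l.+1)).
rewrite -(big_nat_widen 0 (n - 2) n xpredT (fun l => g l - g l.+1)); last by lia.
rewrite (telescope_sumr_eq (fun i => - g i)) //; first by rewrite opprK addrC.
by move=> k _; rewrite opprK addrC.
Qed.

(** The sum defining the last f telescopes to eps_n + eps_1, so that pairing
    with the f_j takes differences of coordinates cyclically, up to a sign at
    the end of the cycle. *)
Lemma form_f_basis x (j : 'I_n) :
  b x (tnth (f_basis e) j) = if (j.+1 < n)%N then eps_coord x j - eps_coord x j.+1
                   else eps_coord x (n - 1) + eps_coord x 0.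
Proof.
rewrite f_basisE; case: ifP => jn; first by rewrite form_root jn.
rewrite dotDr dot_sumr form_root jn.
rewrite (eq_bigr (fun l : 'I_n => eps_coord x l - eps_coord x l.+1)); last first.
  by move=> l ln; rewrite form_root ifT //; lia.
by rewrite sum_first; ring.
Qed.

Lemma eps_coordD x y k : eps_coord (x + y) k = eps_coord x k + eps_coord y k.
Proof.
by rewrite /eps_coord -big_split; apply: eq_bigr => i _; rewrite linearD mulrDl.
Qed.

Lemma eps_coord_sum I r (P : pred I) (E : I -> V) k :
  eps_coord (\sum_(i <- r | P i) E i) k = \sum_(i <- r | P i) eps_coord (E i) k.
Proof.
rewrite /eps_coord exchange_big /=; apply: eq_bigr => i _.
by rewrite linear_sum mulr_suml.
Qed.

Lemma eps_coordZ a x k : eps_coord (a *: x) k = a * eps_coord x k.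
Proof.
by rewrite /eps_coord mulr_sumr; apply: eq_bigr => i _; rewrite linearZ /= mulrA.
Qed.

Lemma eps_coord_f_basis (j : 'I_n) k : (k < n)%N ->
  eps_coord (tnth (f_basis e) j) k =
  if (j.+1 < n)%N then (k == j)%:R - (k == j.+1)%:R
  else (k == n - 1)%N%:R + (k == 0)%N%:R.
Proof.
move=> kn; rewrite f_basisE; case: ifP => jn.
  by rewrite eps_coord_root /root_coord jn.
rewrite eps_coordD eps_coord_sum eps_coord_root /root_coord jn.
rewrite (eq_bigr (fun l : 'I_n => (k == l)%:R - (k == l.+1)%:R)); last first.
  by move=> l ln; rewrite eps_coord_root /root_coord ifT //; lia.
by rewrite (sum_first (fun l => (k == l)%:R)); ring.
Qed.

(** The dual basis vector is half of eps_1 + ... + eps_j - eps_(j+1) - ... - eps_n: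
    the coefficients (n - 2|j - l|)/4 increase by 1/2 up to l = j and then
    decrease by 1/2. *)
Lemma eps_coord_fstar (j : 'I_n) k : (k < n)%N ->
  eps_coord (tnth (fstar_basis e) j) k = if (k <= j)%N then 1/2 else - (1/2).
Proof.
move=> kn; rewrite tnth_mktuple eps_coord_sum.
(* Counting from 0, the coordinate k > 0 receives c k - c (k - 1), and the
   coordinate 0 receives c 0 + c (n - 1), the latter from the last f. *)
pose c (l : nat) : R := (n%:R - 2 * `|j%:R - l%:R|) / 4.
rewrite (eq_bigr (fun l : 'I_n => (c l * (l == k :> nat)%:R) 
  - (c l * (l.+1 < n)%N%:R * (l.+1 == k :> nat)%:R)
  + c l * ((l == n-1 :> nat)%N)%:R * (k == 0)%N%:R)); last first.
  move=> l _; rewrite eps_coordZ eps_coord_f_basis // -/(c l).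
  rewrite -mulrA -!mulrBr -mulrA -mulrDr; congr (_ * _).
  have ltl := ltn_ord l.
  case: (ltnP l.+1 n) => ln;
repeat (match goal with |- context[(?a == ?b) ] => 
   case: (@eqP nat a b) => ? end; try (exfalso; lia));
 rewrite /=; try (exfalso; lia); ring.
rewrite big_split sumrB /= sum_mul_delta //.
rewrite -mulr_suml sum_mul_delta; last lia.
have cE l : c l = if (l <= j)%N then (n%:R - 2 * (j%:R - l%:R)) / 4
    else (n%:R - 2 * (l%:R - j%:R)) / 4.
  rewrite /c; case: leqP => lj.
    by rewrite ger0_norm // subr_ge0 ler_nat.
  by rewrite ler0_norm ?opprB // subr_le0 ler_nat ltnW.
case: k kn => [|k] kn /=.
  rewrite big1 => [|l _]; last by rewrite mulr0.
  rewrite !cE /= mulr1; have jn := ltn_ord j.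
  rewrite natrB; last lia.
  case: leqP => jn1; last by lra.
  have -> : (j : nat) = (n - 1)%N by lia.
  by rewrite natrB; [lra | lia].
rewrite (eq_bigr (fun l : 'I_n => c l * (l.+1 < n)%N%:R * (l == k :> nat)%:R)) //.
rewrite (sum_mul_delta (fun l => c l * (l.+1 < n)%N%:R)); last lia.
rewrite kn mulr1 mulr0 addr0 !cE -(natr1 k).
case: (ltngtP k j) => kj /=; first by lra.
  by lra.
by rewrite kj; lra.
Qed.

End TypeDLattice.

(** * The dual lattice and the map rho *)

Section DualLattice.
Context {R : realType} {V : vectType R} (b : {dot V for (@idfun R)}).
Context {L : set V} {n : nat} {e : n.-tuple V}.
Context (n_ge4 : (4 <= n)%N) (Dn_e : Dn_basis b L e).
Implicit Types (x y : V) (i j k : nat).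

Notation eps := (eps_coord (e := e)).

Lemma form_fstar_f (i j : 'I_n) :
  b (tnth (fstar_basis e) i) (tnth (f_basis e) j) = (j == i)%:R.
Proof.
rewrite (form_f_basis n_ge4 Dn_e) -val_eqE /=.
have ltj := ltn_ord j; have lti := ltn_ord i.
case: ifP => jn; rewrite !(eps_coord_fstar n_ge4 Dn_e) //; try lia.
  by case: (ltngtP j i) => /=; lra.
by rewrite leq0n; case: leqP => ni; case: eqP => ji; try lia; rewrite /=; lra.
Qed.

Lemma fstar_is_basis : basis_of fullv (fstar_basis e).
Proof.
have [[be _] _] := Dn_e.
have dimV : \dim {:V} = n := size_basis be.
rewrite basisEfree subvf size_tuple dimV leqnn !andbT.
apply/freeP => k k0 i.
have : b (\sum_(l < n) k l *: (fstar_basis e)`_l) (tnth (f_basis e) i) = 0.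
  by rewrite k0 linear0l.
rewrite dot_suml (bigD1 i) // big1 => [|l li]; last first.
  by rewrite dotZl -tnth_nth form_fstar_f eq_sym (negbTE li) mulr0.
by rewrite dotZl -tnth_nth form_fstar_f eqxx mulr1 /= addr0.
Qed.

Lemma coord_fstar x (j : 'I_n) :
  coord (fstar_basis e) j x = b x (tnth (f_basis e) j).
Proof.
rewrite [in RHS](coord_basis fstar_is_basis (memvf x)) dot_suml.
rewrite (bigD1 j) // big1 => [|l lj]; last first.
  by rewrite dotZl -tnth_nth form_fstar_f eq_sym (negbTE lj) mulr0.
by rewrite dotZl -tnth_nth form_fstar_f eqxx mulr1 /= addr0.
Qed.

Lemma lattice_dualP x :
  lattice_dual b L x <-> forall j : 'I_n, b x (tnth e j) \is a Num.int.
Proof.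
have [[_ LE] _] := Dn_e; rewrite /lattice_dual LE; split=> [xL j|xe y [z ->]].
  apply: xL; exists (fun l : 'I_n => (l == j)%:Z).
  rewrite (bigD1 j) //= eqxx scale1r big1 ?addr0 // => i /negbTE ->.
  by rewrite scale0r.
by rewrite dot_sumr rpred_sum // => i _; rewrite dotZr rpredM ?xe ?intr_int.
Qed.

Lemma lattice_dualD x y :
  lattice_dual b L x -> lattice_dual b L y -> lattice_dual b L (x + y).
Proof. by move=> dx dy z Lz; rewrite dotDl rpredD ?dx ?dy. Qed.

Lemma lattice_dual0 : lattice_dual b L 0.
Proof. by move=> z Lz; rewrite linear0l. Qed.

Lemma root_dual (j : 'I_n) : lattice_dual b L (tnth e j).
Proof.
apply/lattice_dualP => i; rewrite Dn_e.2 /Dn_gram.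
by case: ifP => _; [exact: natr_int | case: ifP => _; rewrite ?rpredN ?rpred0 ?rpred1].
Qed.

Lemma fstar_dual (j : 'I_n) : lattice_dual b L (tnth (fstar_basis e) j).
Proof.
apply/lattice_dualP => i; rewrite (form_root n_ge4 Dn_e).
have half1 : (1/2 + 1/2 : R) = 1 by lra.
have lti := ltn_ord i.
case: ifP => i1; rewrite !(eps_coord_fstar n_ge4 Dn_e); try lia;
  case: ifP => _; case: ifP => _;
  by rewrite ?opprK ?subrr ?addNr ?half1 -?opprD ?half1 ?rpredN ?rpred0 ?rpred1.
Qed.

Lemma form_f_basis_int x (j : 'I_n) : lattice_dual b L x ->
  b x (tnth (f_basis e) j) \is a Num.int.
Proof.
move=> /lattice_dualP xe; rewrite f_basisE; case: ifP => // _.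
by rewrite dotDr dot_sumr rpredD ?rpred_sum ?xe // => l _; rewrite xe.
Qed.

(** [eps_coord] is only meaningful below n; [z] is a function on nat to avoid
    casts between ordinals. *)
Definition half_integral x (h : bool) (z : nat -> int) :=
  forall k, (k < n)%N -> eps x k = (z k)%:~R + h%:R / 2.

(** Pairing with the f_j makes consecutive differences of coordinates integral,
    and their cyclic closing makes twice the first coordinate integral. *)
Lemma dual_half_integral x : lattice_dual b L x ->
  exists h z, half_integral x h z.
Proof.
move=> dx.
have diff k : (k < n)%N -> eps x 0 - eps x k \is a Num.int.
  elim: k => [|k IH] kn; first by rewrite subrr.
  rewrite -(subrK (eps x k) (eps x 0)) -addrA rpredD ?IH ?(ltnW kn) //.
  have := form_f_basis_int (Ordinal (ltnW kn)) dx.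
  by rewrite (form_f_basis n_ge4 Dn_e) /= kn.
have [t tE] : exists t : int, 2 * eps x 0 = t%:~R.
  apply/intrP; have n1 : (n - 1 < n)%N by lia.
  have := form_f_basis_int (Ordinal n1) dx.
  rewrite (form_f_basis n_ge4 Dn_e) /= ifF; last lia.
  move=> /(rpredD (diff _ n1)); rewrite (_ : _ + _ = 2 * eps x 0) //.
  by ring.
(* The first coordinate is q + h/2, and the others differ from it by integers. *)
have [h [q hq]] : exists (h : bool) (q : int), t = 2 * q + h.
  by exists ((t %% 2)%Z != 0), (t %/ 2)%Z; lia.
exists h, (fun k => q - Num.floor (eps x 0 - eps x k)) => k kn.
rewrite intrD mulrNz floorK ?diff //.
have : 2 * eps x 0 = 2 * q%:~R + h%:R.
  by rewrite tE hq intrD intrM.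
by lra.
Qed.

Lemma double_form_half_integral (n_even : (2 %| n)%N) x y h h' z w :
  half_integral x h z -> half_integral y h' w ->
  2 * b x y = (2 * (\sum_(k < n) z k * w k) + 
     ((h' : int) * (\sum_(k < n) z k) + (h : int) * (\sum_(k < n) w k)
      + (n./2 : int) * ((h : int) * h')))%:~R.
Proof.
move=> xz yw; rewrite (form_eps_coord n_ge4 Dn_e).
rewrite (eq_bigr (fun k : 'I_n => (z k)%:~R * (w k)%:~R + h'%:R / 2 * (z k)%:~R
  + h%:R / 2 * (w k)%:~R + (h%:R * h'%:R / 4))); last first.
  by move=> k _; rewrite xz // yw //; field.
rewrite !big_split /= sumr_const card_ord -!mulr_sumr.
rewrite !(intrD, intrM) !rmorph_sum /=.
under [in RHS]eq_bigr do rewrite intrM.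
have nE : n%:R = 2 * (n./2)%:R :> R.
  by rewrite -natrM; congr (_%:R); lia.
rewrite -[_ *+ n]mulr_natl nE -!pmulrn; by field.
Qed.

Context {F : finFieldType} (cardF : #|F| = 4%N).
Context {omega : F} (omega2 : omega ^+ 2 = omega + 1).

Lemma fstar_coord_half_integral x h z (j : 'I_n) : half_integral x h z ->
  fstar_coord e x j =
  if (j.+1 < n)%N then z j - z j.+1 else z (n - 1)%N + z 0%N + h.
Proof.
move=> xz; rewrite /fstar_coord coord_fstar (form_f_basis n_ge4 Dn_e).
case: ifP => jn.
  rewrite !xz ?ltn_ord // [X in Num.floor X](_ : _ = (z j - z j.+1)%:~R) ?intrKfloor //.
  by rewrite intrB; ring.
rewrite !xz; try lia.
rewrite [X in Num.floor X](_ : _ = (z (n - 1)%N + z 0%N + h)%:~R) ?intrKfloor //.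
by rewrite !intrD -pmulrn; field.
Qed.

Lemma sum_even_pairs (W : nmodType) (g : nat -> W) p :
  \sum_(j < p.*2 | ~~ odd j) (g j + g j.+1) = \sum_(k < p.*2) g k.
Proof.
rewrite big_mkcond; elim: p => [|p IH]; first by rewrite !big_ord0.
by rewrite doubleS !big_ord_recr /= IH odd_double /= addr0 addrA.
Qed.

(** The differences z_j - z_(j+1) telescope to z_1 - z_n, and the last
    coordinate is z_n + z_1 + h. *)
Lemma sum_fstar_coord x h z : half_integral x h z ->
  \sum_(j < n) fstar_coord e x j = 2 * z 0%N + h.
Proof.
move=> xz.
have n0 : (0 < n)%N by lia.
have E : n = n.-1.+1 by lia.
pose g k := if (k.+1 < n)%N then z k - z k.+1 else z (n - 1)%N + z 0%N + h.
rewrite (eq_bigr (fun j : 'I_n => g j)); last first.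
  by move=> j _; rewrite (fstar_coord_half_integral j xz).
rewrite -(big_mkord xpredT g) E big_nat_recr //=.
rewrite (telescope_sumr_eq (fun i => - z i)) //; last first.
  move=> k kn; rewrite /g ifT; last lia.
  by rewrite opprK addrC.
rewrite /g ifF; last lia.
rewrite (_ : (n - 1 = n.-1)%N); last lia.
ring.
Qed.

(** Modulo 2 the coordinates in odd positions are the sums over disjoint
    consecutive pairs of the z_k, hence add up to s; all the coordinates
    together add up to h, so those in even positions add up to s + h. *)
Lemma rho_half_integral (n_even : (2 %| n)%N) x h z : half_integral x h z ->
  rho omega e x = (\sum_(k < n) z k)%:~R + (h : int)%:~R * omega ^+ 2.
Proof.
move=> xz; rewrite /rho.
set S0 := (\sum_(j < n | ~~ odd j) _)%:~R; set S1 := (\sum_(j < n | odd j) _)%:~R.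
have S0E : S0 = (\sum_(k < n) z k)%:~R :> F.
  have nE : n = n./2.*2 by lia.
  rewrite /S0 !rmorph_sum /= [in RHS]nE.
  rewrite -(sum_even_pairs (fun k => (z k)%:~R)) -nE.
  apply: eq_bigr => j jodd; have ltj := ltn_ord j.
  rewrite (fstar_coord_half_integral j xz) ifT; last lia.
  by rewrite intrB (F4_oppr cardF).
have S01 : S0 + S1 = (h : int)%:~R.
  have := sum_fstar_coord xz.
  rewrite (bigID (fun j : 'I_n => odd j)) /= => sumE.
  rewrite addrC -intrD sumE.
  have /eqP : ((2 * z 0%N)%:~R == 0 :> F) by rewrite (F4_intr_eq0 cardF); lia.
  by rewrite intrD => ->; rewrite add0r.
have -> : S1 = (h : int)%:~R + S0.
  by rewrite -S01 addrAC (F4_addrr cardF) add0r.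
rewrite mulrDl addrCA -mulrDr (omega_add_omega2 cardF omega2) mulr1 addrC.
by rewrite S0E.
Qed.

End DualLattice.

Section ResidueMap.
Context {R : realType} {V : vectType R} (b : {dot V for (@idfun R)}).
Context {L : set V} {n : nat} {e : n.-tuple V}.
Context (n_ge4 : (4 <= n)%N) (n_even : (2 %| n)%N) (Dn_e : Dn_basis b L e).
Context {F : finFieldType} (cardF : #|F| = 4%N).
Context {omega : F} (omega2 : omega ^+ 2 = omega + 1).
Implicit Types (x y : V) (a : F).

Notation rho := (rho omega e).
Notation dual := (lattice_dual b L).

(** The exponent of the conjugation on the second factor: 1 for the Euclidean
    product, 2 for the Hermitian one. *)
Definition twist : nat := if odd n./2 then 1%N else 2%N.

(** The value modulo 4 of 2 b(x, x) on the class rho(x) = a. *)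
Definition residue_weight a : nat :=
  if a == 0 then 0%N else if a == 1 then 2%N else n./2.

Lemma twist_in : twist \in [:: 1; 2]%N.
Proof. by rewrite /twist; case: ifP. Qed.

(** The term (n/2) h h' is present modulo 2 exactly when n/2 is odd, which is
    what separates the Euclidean trace form from the Hermitian one. *)
Lemma form_trace_rho x y : dual x -> dual y ->
  exists2 K : int, 2 * b x y = K%:~R & K%:~R = trace (rho x * rho y ^+ twist).
Proof.
move=> /(dual_half_integral n_ge4 Dn_e)[h [z xz]].
move=> /(dual_half_integral n_ge4 Dn_e)[h' [w yw]].
eexists; first exact: (double_form_half_integral n_ge4 Dn_e n_even xz yw).
rewrite (rho_half_integral n_ge4 Dn_e cardF omega2 n_even xz).
rewrite (rho_half_integral n_ge4 Dn_e cardF omega2 n_even yw) /twist.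
rewrite intrD (_ : (2 * _)%:~R = 0) ?add0r; last first.
  by apply/eqP; rewrite (F4_intr_eq0 cardF); lia.
case: ifP => n2.
  rewrite expr1 (trace_euclidean cardF omega2) !intrD !intrM; congr (_ + _).
  by rewrite -pmulrn (F4_natr cardF) n2 mul1r.
rewrite (trace_hermitian cardF omega2) !intrD !intrM.
by rewrite -[(n./2 : int)%:~R]pmulrn (F4_natr cardF) n2 mul0r addr0.
Qed.

Lemma form_int_trace x y : dual x -> dual y -> b x y \is a Num.int ->
  trace (rho x * rho y ^+ twist) = 0.
Proof.
move=> dx dy; have [K KE <-] := form_trace_rho dx dy.
move=> /intrP[k kE]; apply/eqP; rewrite (F4_intr_eq0 cardF).
move: KE; rewrite kE => KE.
have : (2 * k)%:~R = K%:~R :> R by rewrite intrM.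
by move=> /intr_inj <-; lia.
Qed.

(** Since z_k^2 = z_k modulo 2, twice the norm is 2 s + h (2 s + n/2) modulo 4:
    it is 2 s if h = 0, and n/2 if h = 1. *)
Lemma norm_residue_weight x : dual x ->
  exists K : int, 2 * b x x = ((residue_weight (rho x) : int) + 4 * K)%:~R.
Proof.
move=> /(dual_half_integral n_ge4 Dn_e)[h [z xz]].
rewrite (double_form_half_integral n_ge4 Dn_e n_even xz xz).
rewrite (rho_half_integral n_ge4 Dn_e cardF omega2 n_even xz).
have [t tE] : exists t : int, \sum_(k < n) z k * z k = \sum_(k < n) z k + 2 * t.
  exists (\sum_(k < n) ((z k * z k - z k) %/ 2)%Z).
  rewrite mulr_sumr -big_split; apply: eq_bigr => k _ /=.
  suff : (2 %| z k * z k - z k)%Z by lia.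
  have : (2 %| z k)%Z || (2 %| z k - 1)%Z by lia.
  rewrite (_ : z k * z k - z k = z k * (z k - 1)); last by ring.
  case/orP => d.
    exact: dvdz_mulr.
  exact: dvdz_mull.
rewrite tE; set s := \sum_(k < n) z k.
have [q [r sE]] : exists (q : int) (r : bool), s = 2 * q + r.
  by exists (s %/ 2)%Z, ((s %% 2)%Z != 0); lia.
have sF : s%:~R = r%:R :> F.
  rewrite sE intrD -pmulrn (_ : (2 * q)%:~R = 0) ?add0r //.
  by apply/eqP; rewrite (F4_intr_eq0 cardF); lia.
rewrite /residue_weight sF sE -pmulrn.
case: h {xz} => /=; rewrite ?mul1r ?mul0r ?addr0; last first.
  exists (q + t); congr (_%:~R).
  by case: (r); rewrite /= ?oner_eq0 ?eqxx; lia.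
exists (2 * q + r + t).
case: (r); rewrite /= ?add0r; last first.
  rewrite expf_eq0 (negbTE (omega_neq0 omega2)) (negbTE (omega2_neq1 omega2)) /=.
  by congr (_%:~R); lia.
rewrite (one_add_omega2 cardF omega2) (negbTE (omega_neq0 omega2)).
rewrite (negbTE (omega_neq1 omega2)).
by congr (_%:~R); lia.
Qed.

Lemma rhoD x y : dual x -> dual y -> rho (x + y) = rho x + rho y.
Proof.
move=> dx dy.
have fD (j : 'I_n) : fstar_coord e (x + y) j = fstar_coord e x j + fstar_coord e y j.
  rewrite /fstar_coord linearD /= floorDrz //.
  by rewrite (coord_fstar n_ge4 Dn_e) (form_f_basis_int Dn_e).
have sumD (P : pred 'I_n) : \sum_(j < n | P j) fstar_coord e (x + y) j =
    \sum_(j < n | P j) fstar_coord e x j + \sum_(j < n | P j) fstar_coord e y j.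
  by rewrite -big_split; apply: eq_bigr => j _; apply: fD.
by rewrite /Defs.rho !sumD !intrD; ring.
Qed.

Lemma fstar_coord_fstar (i j : 'I_n) :
  fstar_coord e (tnth (fstar_basis e) i) j = (j == i).
Proof.
rewrite /fstar_coord (coord_fstar n_ge4 Dn_e) (form_fstar_f n_ge4 Dn_e).
by rewrite pmulrn intrKfloor.
Qed.

Lemma rho_fstar (i : 'I_n) :
  rho (tnth (fstar_basis e) i) = if odd i then omega ^+ 2 else omega.
Proof.
rewrite /Defs.rho.
have sumE (P : pred 'I_n) :
    \sum_(j < n | P j) fstar_coord e (tnth (fstar_basis e) i) j = P i.
  under eq_bigr do rewrite fstar_coord_fstar.
  rewrite big_mkcond (bigD1 i) //= eqxx big1 ?addr0; first by case: (P i).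
  by move=> j /negbTE ->; case: ifP.
rewrite (sumE (fun j => ~~ odd j)) (sumE (fun j => odd j)).
by case: odd; rewrite /= ?mul0r ?mul1r ?addr0 ?add0r.
Qed.

Lemma rho0 : rho 0 = 0.
Proof.
have d0 := lattice_dual0 b (L := L).
by apply: (addrI (rho 0)); rewrite -rhoD // !addr0.
Qed.

Lemma rho_surjective a : exists2 x, dual x & rho x = a.
Proof.
have n0 : (0 < n)%N by lia.
have n1 : (1 < n)%N by lia.
have d0 := fstar_dual n_ge4 Dn_e (Ordinal n0).
have d1 := fstar_dual n_ge4 Dn_e (Ordinal n1).
have [[] [[] ->]] := F4_elements cardF omega2 a; rewrite ?mul0r ?mul1r ?addr0 ?add0r.
- exists (tnth (fstar_basis e) (Ordinal n0)); rewrite // rho_fstar /=.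
  by rewrite (one_add_omega2 cardF omega2).
- exists (tnth (fstar_basis e) (Ordinal n0) + tnth (fstar_basis e) (Ordinal n1)).
    exact: lattice_dualD.
  by rewrite rhoD // !rho_fstar (omega_add_omega2 cardF omega2).
- by exists (tnth (fstar_basis e) (Ordinal n1)); rewrite // rho_fstar.
- by exists 0; [exact: lattice_dual0 | exact: rho0].
Qed.

(** A root pairs integrally with the whole dual lattice, so its image is
    trace-orthogonal to all of F, as rho is surjective. *)
Lemma rho_root (j : 'I_n) : rho (tnth e j) = 0.
Proof.
apply: (trace_form_nondegenerate cardF omega2 twist_in) => a.
have [y dy <-] := rho_surjective a; apply: form_int_trace => //.
  exact: root_dual.
by rewrite dotC; apply: (lattice_dualP Dn_e y).1.
Qed.

End ResidueMap.

(** * Codes, twisted duals and weights *)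

Section CodeWeights.
Context {F : finFieldType} {m : nat}.
Implicit Types (x y : 'rV[F]_m) (C : {vspace 'rV[F]_m}).

(** The Euclidean dual for [kappa = 1] and the Hermitian dual for [kappa = 2]. *)
Definition twisted_dual kappa C : {set 'rV[F]_m} :=
  [set x : 'rV[F]_m | [forall y in code_set C,
    \sum_(i < m) x 0 i * y 0 i ^+ kappa == 0]]%SET.

Lemma twisted_dualP kappa C x :
  reflect (forall y, y \in C -> \sum_(i < m) x 0 i * y 0 i ^+ kappa = 0)
          (x \in twisted_dual kappa C).
Proof.
rewrite inE; apply: (iffP forall_inP) => H y yC.
  by apply/eqP/H; rewrite inE.
by apply/eqP/H; rewrite inE in yC.
Qed.

Lemma euclidean_dualE C : euclidean_dual C = twisted_dual 1 C.
Proof.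
apply/setP => x; rewrite !inE; apply: eq_forallb => y.
by congr (_ ==> (_ == _)); apply: eq_bigr => i _; rewrite expr1.
Qed.

Lemma hermitian_dualE C : hermitian_dual C = twisted_dual 2 C.
Proof.
apply/setP => x; apply/idP/twisted_dualP.
  rewrite inE => /forall_inP H y yC.
  have := H (map_mx (fun a => a ^+ 2) y).
  rewrite imset_f ?inE // => /(_ isT) /eqP xy.
  by rewrite -[RHS]xy /code_dot; apply: eq_bigr => i _; rewrite mxE.
move=> H; rewrite inE; apply/forall_inP => z /imsetP[y]; rewrite inE => yC ->.
by apply/eqP; rewrite -[RHS](H y yC) /code_dot; apply: eq_bigr => i _; rewrite mxE.
Qed.

(** The truncated subtractions in [N1] do subtract, the coordinates equal to 0
    and those equal to 1 being disjoint. *)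
Lemma N1E x : N1 x = #|[set i | (x 0 i != 0) && (x 0 i != 1)]%SET|.
Proof.
rewrite /N1 /N0 /N2 -subnDA.
set A := [set i | _]%SET; set B := [set i | _]%SET.
have AB0 : A :&: B = finset.set0.
  apply/setP => i; rewrite !inE.
  by case: eqP => // ->; rewrite eq_sym oner_eq0.
have := cardsCs (A :|: B); rewrite cardsU AB0 cards0 subn0 card_ord => ->.
rewrite subKn; last by rewrite -[X in (_ <= X)%N]card_ord max_card.
by apply: eq_card => i; rewrite !inE negb_or.
Qed.

Lemma card_set_sum (P : pred 'I_m) : #|[set i | P i]%SET| = (\sum_(i < m) P i)%N.
Proof.
by rewrite -sum1dep_card big_mkcond; apply: eq_bigr => i _; case: (P i).
Qed.

Lemma wtHE x : wtH x = #|[set i | x 0 i != 0]%SET|.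
Proof.
rewrite /wtH N1E /N2 !card_set_sum -big_split; apply: eq_bigr => i _ /=.
have [->|x1] := eqVneq (x 0 i) 1; first by rewrite oner_eq0.
by rewrite andbT addn0.
Qed.

Lemma sum_residue_weight n x :
  (\sum_(i < m) residue_weight (n := n) (x 0%R i) = n./2 * N1 x + 2 * N2 x)%N.
Proof.
rewrite N1E /N2 !card_set_sum !big_distrr -big_split; apply: eq_bigr => i _ /=.
rewrite /residue_weight.
have [->|x0] := eqVneq (x 0 i) 0; first by rewrite eq_sym oner_eq0 !muln0.
by have [_|_] := eqVneq (x 0 i) 1; rewrite /= ?muln1 ?muln0 ?addn0.
Qed.

(** Nonzero elements of F satisfy a a^2 = 1, so the Hermitian norm of x counts
    its nonzero coordinates modulo 2. *)
Lemma hermitian_even_wtH (cardF : #|F| = 4%N) C x :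
  x \in C -> x \in twisted_dual 2 C -> (2 %| wtH x)%N.
Proof.
move=> xC /twisted_dualP /(_ x xC) xx.
rewrite (dvdn_pcharf (F4_char2 cardF)) wtHE card_set_sum natr_sum -[X in _ == X]xx.
apply/eqP; apply: eq_bigr => i _; rewrite -exprS.
by have [->|x0] := eqVneq (x 0 i) 0; rewrite ?expr0n // (F4_cube cardF).
Qed.

End CodeWeights.

(** * Lattices glued from codes *)

Section GluedLattice.
Context {R : realType} {V : vectType R} (b : {dot V for (@idfun R)}).
Context {L : set V} {n : nat} {e : n.-tuple V}.
Context (n_ge4 : (4 <= n)%N) (n_even : (2 %| n)%N) (Dn_e : Dn_basis b L e).
Context {F : finFieldType} (cardF : #|F| = 4%N).
Context {omega : F} (omega2 : omega ^+ 2 = omega + 1).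
Context {m : nat} (C : {vspace 'rV[F]_m}).
Implicit Types (x y : {ffun 'I_m -> V}) (c d : 'rV[F]_m).

Notation dual := (lattice_dual b L).
Notation Gamma_C := (Gamma omega e b L C).
Notation B := (form_sum b).
Notation twist := (twist (n := n)).

Lemma form_sumDl x1 x2 y : B (x1 + x2) y = B x1 y + B x2 y.
Proof.
by rewrite /form_sum -big_split; apply: eq_bigr => i _; rewrite ffunE dotDl.
Qed.

Lemma form_sumC x y : B x y = B y x.
Proof. by apply: eq_bigr => i _; rewrite dotC. Qed.

Lemma rho_sum_surjective c :
  exists2 x : {ffun 'I_m -> V}, forall i, dual (x i) & rho_sum omega e x = c.
Proof.
have /fin_all_exists2[x dx xE] (i : 'I_m) :=
  rho_surjective n_ge4 n_even Dn_e cardF omega2 (c 0 i).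
exists [ffun i => x i]; first by move=> i; rewrite ffunE.
by apply/rowP => i; rewrite mxE ffunE xE.
Qed.

Lemma form_sum_int x y : (forall i, dual (x i)) -> (forall i, dual (y i)) ->
  (B x y \is a Num.int) =
  (trace (\sum_(i < m) rho_sum omega e x 0 i *
    rho_sum omega e y 0 i ^+ twist) == 0).
Proof.
move=> dx dy.
have /fin_all_exists2[K KE Ktr] (i : 'I_m) :=
  form_trace_rho n_ge4 n_even Dn_e cardF omega2 (dx i) (dy i).
have -> : trace (\sum_(i < m) rho_sum omega e x 0 i *
      rho_sum omega e y 0 i ^+ twist) =
    (\sum_i K i)%:~R.
  rewrite (trace_sum cardF) rmorph_sum /=; apply: eq_bigr => i _.
  by rewrite !mxE Ktr.
have BE : 2 * B x y = (\sum_i K i)%:~R.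
  by rewrite /form_sum mulr_sumr rmorph_sum; apply: eq_bigr => i _; rewrite KE.
rewrite (F4_intr_eq0 cardF); apply/idP/idP => [/intrP[k Bk]|K2].
  have : (2 * k)%:~R = (\sum_i K i)%:~R :> R by rewrite -BE Bk intrM.
  by move/intr_inj => <-; rewrite dvdz_mulr.
apply/intrP; exists ((\sum_i K i) %/ 2)%Z.
apply: (@mulfI R 2) => //; first by rewrite pnatr_eq0.
by rewrite BE -[in LHS](divzK K2) mulrC intrM.
Qed.

Lemma form_sum_even x : (forall i, dual (x i)) ->
  (exists k : int, B x x = (2 * k)%:~R) <->
  (4 %| n./2 * N1 (rho_sum omega e x) + 2 * N2 (rho_sum omega e x))%N.
Proof.
move=> dx.
have /fin_all_exists[K KE] (i : 'I_m) :=
  norm_residue_weight n_ge4 n_even Dn_e cardF omega2 (dx i).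
rewrite -sum_residue_weight.
set w := (\sum_(i < m) _)%N.
have BE : 2 * B x x = ((w : int) + 4 * \sum_i K i)%:~R.
  rewrite /form_sum mulr_sumr (eq_bigr _ (fun i _ => KE i)) -rmorph_sum /=.
  rewrite big_split -mulr_sumr /w -natz natr_sum; congr (_ + _)%:~R.
  by apply: eq_bigr => i _; rewrite mxE natz.
split=> [[k Bk]|w4].
  have : (2 * (2 * k))%:~R = ((w : int) + 4 * \sum_i K i)%:~R :> R.
    by rewrite -BE Bk intrM.
  by move/intr_inj => H; lia.
have wE : (w : int) = 4 * ((w %/ 4)%N : int) by lia.
exists (((w %/ 4)%N : int) + \sum_i K i).
apply: (@mulfI R 2); first by rewrite pnatr_eq0.
by rewrite BE {1}wE !(intrD, intrM); ring.
Qed.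

Lemma rho_sumD x y : (forall i, dual (x i)) -> (forall i, dual (y i)) ->
  rho_sum omega e (x + y) = rho_sum omega e x + rho_sum omega e y.
Proof.
move=> dx dy; apply/rowP => i.
by rewrite !mxE ffunE (rhoD n_ge4 Dn_e).
Qed.

(** C is stable under multiplication by any a in F, so the vanishing of traces
    on C gives the vanishing of the products themselves. *)
Lemma trace_twisted_dual c :
  (forall d, d \in C -> trace (\sum_(i < m) c 0 i * d 0 i ^+ twist) = 0) ->
  c \in twisted_dual twist C.
Proof.
move=> tr0; apply/twisted_dualP => d dC.
apply: (trace_form_nondegenerate cardF omega2 (twist_in (n := n))) => a.
rewrite -[RHS](tr0 (a *: d)) ?memvZ // mulr_suml; congr trace.
by apply: eq_bigr => i _; rewrite mxE exprMn [a ^+ _ * _]mulrC mulrA.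
Qed.

(** A vector of the dual pairs integrally with the vectors of Gamma_C having a
    single nonzero component, which is a root; this puts its components in the
    dual lattice, and the trace form finishes. *)
Lemma dual_Gamma x :
  lattice_dual B Gamma_C x <->
  (forall i, dual (x i)) /\ rho_sum omega e x \in twisted_dual twist C.
Proof.
have trace0 : trace (0 : F) = 0 by rewrite /trace expr0n addr0.
split=> [xG|[dx xC] y [dy yC]]; last first.
  rewrite form_sum_int //.
  by move/twisted_dualP: xC => /(_ _ yC) ->; rewrite trace0.
have dx i : dual (x i).
  apply/(lattice_dualP Dn_e) => j.
  pose y : {ffun 'I_m -> V} := [ffun l => if l == i then tnth e j else 0].
  have -> : b (x i) (tnth e j) = B x y.
    rewrite /form_sum (bigD1 i) //= ffunE eqxx big1 ?addr0 // => l /negbTE li.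
    by rewrite ffunE li linear0r.
  apply: xG; split=> [l|].
    rewrite ffunE; case: eqP => _; first exact: root_dual.
    exact: lattice_dual0.
  rewrite (_ : rho_sum _ _ _ = 0) ?mem0v //; apply/rowP => l.
  rewrite !mxE ffunE; case: eqP => _; last exact: (rho0 n_ge4 Dn_e).
  exact: (rho_root n_ge4 n_even Dn_e cardF omega2).
split=> //; apply: trace_twisted_dual => d dC.
have [y dy yd] := rho_sum_surjective d.
apply/eqP; rewrite -yd -form_sum_int //.
by apply: xG; split; rewrite ?yd.
Qed.

Lemma integral_Gamma :
  integral_lattice B Gamma_C <-> code_set C \subset twisted_dual twist C.
Proof.
split=> [GI|CC x y Gx Gy].
  apply/fintype.subsetP => c; rewrite inE => cC; have [x dx xc] := rho_sum_surjective c.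
  rewrite -xc; apply: ((dual_Gamma x).1 _).2 => y Gy.
  by apply: GI => //; split; rewrite ?xc.
have [dx xC] := Gx.
by apply: (dual_Gamma x).2 Gy; split=> //; apply: (fintype.subsetP CC); rewrite inE.
Qed.

Lemma unimodular_Gamma :
  unimodular_lattice B Gamma_C <-> code_set C = twisted_dual twist C.
Proof.
split=> [GU|CC].
  apply/setP => c; rewrite inE; have [x dx <-] := rho_sum_surjective c.
  have GU' : lattice_dual B Gamma_C x <-> Gamma_C x by rewrite GU.
  apply/idP/idP => xC; first by apply: ((dual_Gamma x).1 _).2; apply: GU'.2.
  by apply: (GU'.1 _).2; apply/dual_Gamma.
apply/seteqP; split=> x.
  by move/dual_Gamma => [dx]; rewrite -CC inE.
by case=> dx xC; apply/dual_Gamma; split; rewrite // -CC inE.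
Qed.

(** Gamma_C is closed under addition, so an even norm makes the form integral by
    polarization. *)
Lemma even_Gamma :
  even_lattice B Gamma_C <->
  forall c, c \in C -> (4 %| n./2 * N1 c + 2 * N2 c)%N.
Proof.
split=> [[_ GE] c cC|CE].
  have [x dx xc] := rho_sum_surjective c.
  by rewrite -xc; apply/form_sum_even => //; apply: GE; split; rewrite ?xc.
have GE x : Gamma_C x -> exists k : int, B x x = (2 * k)%:~R.
  by case=> dx xC; apply/form_sum_even => //; apply: CE.
split=> // x y Gx Gy; have [[dx xC] [dy yC]] := (Gx, Gy).
have Gxy : Gamma_C (x + y).
  split=> [i|]; first by rewrite ffunE; apply: lattice_dualD.
  by rewrite rho_sumD // memvD.
have [[[k kE] [l lE]] [j jE]] := (GE _ Gx, GE _ Gy, GE _ Gxy).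
apply/intrP; exists (j - k - l).
apply: (@mulfI R 2); first by rewrite pnatr_eq0.
have <- : B (x + y) (x + y) - B x x - B y y = 2 * B x y.
  by rewrite !(form_sumDl, form_sumC _ (x + y)) (form_sumC y x); ring.
by rewrite jE kE lE !intrB !intrM; ring.
Qed.

End GluedLattice.

(** * The theorem *)

Section WeightCongruences.
Implicit Types (d u w : nat).

Lemma dvd4_odd_weight d u w : odd d ->
  (4 %| d * u + 2 * w)%N = (4 %| u + 2 * w)%N.
Proof.
move=> d_odd; have [q [->|->]] : exists q, (d = 4 * q + 1 \/ d = 4 * q + 3)%N.
- by exists (d %/ 4)%N; lia.
- by rewrite mulnDl -mulnA; move: (q * u)%N => v; lia.
- by rewrite mulnDl -mulnA; move: (q * u)%N => v; lia.
Qed.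

Lemma dvd4_2mod4_weight d u w : (d %% 4 = 2)%N ->
  (4 %| d * u + 2 * w)%N = (2 %| u + w)%N.
Proof.
move=> d2; rewrite (divn_eq d 4) d2 mulnDl mulnAC.
by move: (d %/ 4 * u)%N => v; lia.
Qed.

Lemma dvd4_0mod4_weight d u w : (4 %| d)%N ->
  (4 %| d * u + 2 * w)%N = (2 %| 2 * u + w)%N.
Proof.
case/dvdnP => q ->; rewrite mulnAC.
by move: (q * u)%N => v; lia.
Qed.

End WeightCongruences.

Theorem theorem3p18 (R : realType) (V : vectType R)
    (b : {dot V for (@idfun R)}) (L : set V)
    (n m : nat) (hn4 : (4 <= n)%N) (hneven : (2 %| n)%N) (hm : (0 < m)%N)
    (e : n.-tuple V) (hL : Dn_basis b L e)
    (F : finFieldType) (hF : #|F| = 4%N)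
    (omega : F) (homega : omega ^+ 2 = omega + 1)
    (C : {vspace 'rV[F]_m}) :
  let B := form_sum b in
  let GammaC := Gamma omega e b L C in
  (~~ (4 %| n)%N ->
    [/\ integral_lattice B GammaC <-> code_set C \subset euclidean_dual C,
        unimodular_lattice B GammaC <-> euclidean_selfdual C,
        even_lattice B GammaC <-> (forall x, x \in C -> (4 %| wtL x)%N)
      & even_lattice B GammaC /\ unimodular_lattice B GammaC <-> typeII C])
  /\
  ((4 %| n)%N -> ~~ (8 %| n)%N ->
    [/\ integral_lattice B GammaC <-> code_set C \subset hermitian_dual C,
        unimodular_lattice B GammaC <-> hermitian_selfdual C,
        even_lattice B GammaC <-> (forall x, x \in C -> (2 %| wtH x)%N)
      & even_lattice B GammaC /\ unimodular_lattice B GammaC <->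
        hermitian_selfdual C])
  /\
  ((8 %| n)%N ->
    [/\ integral_lattice B GammaC <-> code_set C \subset hermitian_dual C,
        unimodular_lattice B GammaC <-> hermitian_selfdual C,
        even_lattice B GammaC <-> (forall x, x \in C -> (2 %| wtB x)%N)
      & even_lattice B GammaC /\ unimodular_lattice B GammaC <->
        hermitian_selfdual C /\ (forall x, x \in C -> (2 %| wtB x)%N)]).
Proof.
move=> B GammaC.
have integralC : integral_lattice B GammaC <-> _ :=
  integral_Gamma hn4 hneven hL hF homega C.
have unimodularC : unimodular_lattice B GammaC <-> _ :=
  unimodular_Gamma hn4 hneven hL hF homega C.
have evenC : even_lattice B GammaC <-> _ :=
  even_Gamma hn4 hneven hL hF homega C.
split=> [n4|].
  have n2 : odd n./2 by lia.
  move: integralC unimodularC; rewrite /twist n2 -euclidean_dualE => iC uC.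
  have evenL : even_lattice B GammaC <-> (forall x, x \in C -> (4 %| wtL x)%N).
    by split=> [/evenC|] EC; [|apply/evenC] => x /EC; rewrite dvd4_odd_weight.
  split=> //; rewrite /typeII /euclidean_selfdual.
  by split=> -[? ?]; split; [exact/uC | exact/evenL | exact/evenL | exact/uC].
split=> [n4 n8|n8].
  have n2 : odd n./2 = false by lia.
  have n24 : (n./2 %% 4 = 2)%N by lia.
  move: integralC unimodularC; rewrite /twist n2 -hermitian_dualE => iC uC.
  have evenH : even_lattice B GammaC <-> (forall x, x \in C -> (2 %| wtH x)%N).
    by split=> [/evenC|] EC; [|apply/evenC] => x /EC; rewrite dvd4_2mod4_weight.
  split=> //; split=> [[_ /uC]//|CC]; split; last exact/uC.
  apply/evenH => x xC; apply: (hermitian_even_wtH hF xC).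
  by rewrite -hermitian_dualE -CC inE.
have n2 : odd n./2 = false by lia.
have n24 : (4 %| n./2)%N by lia.
move: integralC unimodularC; rewrite /twist n2 -hermitian_dualE => iC uC.
have evenB : even_lattice B GammaC <-> (forall x, x \in C -> (2 %| wtB x)%N).
  by split=> [/evenC|] EC; [|apply/evenC] => x /EC; rewrite dvd4_0mod4_weight.
split=> //.
by split=> -[? ?]; split; [exact/uC | exact/evenB | exact/evenB | exact/uC].
Qed.
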